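(* Let $\alpha=(\alpha_i)_{i\ge1}$, $\beta=(\beta_i)_{i\ge1}$ be sequences of non-negative reals with convergent sums, let $\gamma\ge0$ be real, and let $x=(x_1,x_2,\dots)$ be variables. Then $$\sum_\lambda S_\lambda(\alpha,\beta,\gamma)\,s_\lambda(x)=\sum_\lambda\frac1{z_\lambda}\,\tilde p_\lambda(\alpha,\beta,\gamma)\,p_\lambda(x),$$ where both sums are over all partitions $\lambda$ (of all non-negative integers).
   Context: **Extended Schur functions.** The extended complete symmetric functions $\tilde h_k(\alpha,\beta,\gamma)$ are defined by $$\sum_{k\ge0}\tilde h_k(\alpha,\beta,\gamma)z^k=e^{\gamma z}\prod_{i\ge1}\frac{1+\beta_iz}{1-\alpha_iz},$$ with $\tilde h_k=0$ for $k<0$. For a partition $\lambda=(\lambda_1,\dots,\lambda_m)$, $S_\lambda(\alpha,\beta,\gamma)=\det(\tilde h_{\lambda_i-i+j})_{i,j=1}^m$. **Extended power sums.** $\tilde p_1(\alpha,\beta,\gamma)=\gamma+\sum_i\alpha_i+\sum_i\beta_i$; for $m\ge2$, $\tilde p_m(\alpha,\beta,\gamma)=\sum_i\alpha_i^m+(-1)^{m+1}\sum_i\beta_i^m$; and $\tilde p_\lambda=\prod_i\tilde p_{\lambda_i}$, the product over the parts of $\lambda$. $s_\lambda(x)$ and $p_\lambda(x)$ are the usual Schur and power sum symmetric functions, and $z_\lambda=\prod_{i\ge1}i^{m_i}m_i!$, where $m_i$ is the number of parts of $\lambda$ of size $i$. The identity is one of formal power series in the variables $x_r$. *)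

(* Defs.v *)
From mathcomp Require Import all_boot all_order all_algebra.
From mathcomp Require Import finmap.
From mathcomp Require Import all_classical all_reals all_analysis.

Set Implicit Arguments.
Unset Strict Implicit.
Unset Printing Implicit Defensive.

Import Order.TTheory GRing.Theory Num.Theory.
Import numFieldNormedType.Exports.

Local Open Scope classical_set_scope.
Local Open Scope ring_scope.

(* A partition is the list of its parts: weakly decreasing, all positive.
   [::] is the partition of 0. *)
Definition is_partition (l : seq nat) : bool :=
  sorted geq l && all (ltn 0%N) l.

Definition partitions : set (seq nat) := [set l | is_partition l].

Definition z_part (l : seq nat) : nat :=
  (\prod_(1 <= i < (sumn l).+1) (i ^ count_mem i l * (count_mem i l)`!))%N.

Section ExtendedFunctions.
Variable R : realType.
Implicit Types (alpha beta : R^nat) (gamma : R).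

(* Formal power series in the single variable z, as coefficient sequences;
   multiplication is the Cauchy product. *)
Definition zser_one : R^nat := fun k => (k == 0%N)%:R.

Definition zser_mul (f g : R^nat) : R^nat :=
  fun k => \sum_(i < k.+1) f i * g (k - i)%N.

(* 1 + b z *)
Definition zser_linear (b : R) : R^nat :=
  fun k => if k == 0%N then 1 else if k == 1%N then b else 0.

(* 1 / (1 - a z) *)
Definition zser_geometric (a : R) : R^nat := fun k => a ^+ k.

(* e^(gamma z) times the product of the first n factors
   (1 + beta_i z) / (1 - alpha_i z) *)
Definition ext_gen_partial alpha beta gamma (n : nat) : R^nat :=
  zser_mul (exp_coeff gamma)
    (\big[zser_mul/zser_one]_(i < n)
       zser_mul (zser_linear (beta i)) (zser_geometric (alpha i))).

(* The infinite product of power series is the coefficientwise limit of the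
   partial products; the limit exists when alpha and beta are non-negative
   with convergent sums. Sequences are indexed from 0 instead of 1. *)
Definition ext_h_nat alpha beta gamma (k : nat) : R :=
  limn (fun n => ext_gen_partial alpha beta gamma n k).

Definition ext_h alpha beta gamma (k : int) : R :=
  match k with
  | Posz n => ext_h_nat alpha beta gamma n
  | Negz _ => 0
  end.

(* Indexing rows and columns from 0 does not change the difference j - i. *)
Definition ext_schur alpha beta gamma (l : seq nat) : R :=
  \det (\matrix_(i < size l, j < size l)
          ext_h alpha beta gamma ((nth 0%N l i)%:Z - i%:Z + j%:Z)).

(* Only used for m >= 1; the value at m = 0 is irrelevant. *)
Definition ext_p1 alpha beta gamma (m : nat) : R :=
  if m == 1%N then gamma + limn (series alpha) + limn (series beta)
  else limn (series (fun i => alpha i ^+ m))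
       + (-1) ^+ m.+1 * limn (series (fun i => beta i ^+ m)).

Definition ext_p alpha beta gamma (l : seq nat) : R :=
  \prod_(k <- l) ext_p1 alpha beta gamma k.

End ExtendedFunctions.

(* Monomials in the variables x_0, x_1, x_2, ..., as finitely supported
   exponent functions *)
Notation mono := {fsfun nat -> nat with 0%N}.

(* The product of the variables whose indices are listed in s; it is 1 when
   s = [::]. *)
Definition mono_of_seq (s : seq nat) : mono :=
  [fsfun r in seq_fset tt s => count_mem r s].

Section FormalPowerSeries.
Variable R : realType.

(* Formal power series in x_0, x_1, x_2, ..., as coefficient functions *)
Definition fps : Type := mono -> R.

Definition fps_mono (m : mono) : fps := fun m' => (m' == m)%:R.

Definition fps_one : fps := fps_mono (mono_of_seq [::]).

(* The sum runs over the factorizations m = ab.1 * ab.2; there are finitely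
   many. *)
Definition fps_mul (f g : fps) : fps := fun m =>
  \sum_(ab \in [set ab : mono * mono | forall r, (ab.1 r + ab.2 r)%N = m r])
     f ab.1 * g ab.2.

Definition fps_scale (c : R) (f : fps) : fps := fun m => c * f m.

(* A family of power series is summable when each monomial has a nonzero
   coefficient in only finitely many members; its sum is then formed
   coefficientwise. (fps_sum takes the value 0 at a monomial for which this
   finiteness fails.) *)
Definition fps_summable (I : choiceType) (D : set I) (F : I -> fps) : Prop :=
  forall m : mono, finite_set [set i | D i /\ F i m != 0].

Definition fps_sum (I : choiceType) (D : set I) (F : I -> fps) : fps :=
  fun m => \sum_(i \in D) F i m.

(* Semistandard tableaux of shape l, as lists of rows (English convention):
   weakly increasing along rows, strictly increasing down columns; the entries
   are indices of variables. On a partition shape, zipping a row with the next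
   one pairs every entry of the lower row with the entry above it. *)
Definition is_ssyt (l : seq nat) (T : seq (seq nat)) : bool :=
  [&& shape T == l,
      all (sorted leq) T
    & sorted (fun up down : seq nat =>
                all (fun p : nat * nat => (p.1 < p.2)%N) (zip up down)) T].

(* s_l(x) as the generating function of semistandard tableaux *)
Definition schur (l : seq nat) : fps :=
  fps_sum [set T | is_ssyt l T] (fun T => fps_mono (mono_of_seq (flatten T))).

(* Sum over r of x_r^k, for k >= 1 *)
Definition powersum1 (k : nat) : fps :=
  fps_sum [set: nat] (fun r => fps_mono (mono_of_seq (nseq k r))).

Definition powersum (l : seq nat) : fps :=
  \big[fps_mul/fps_one]_(k <- l) powersum1 k.

End FormalPowerSeries.

Arguments schur : clear implicits.
Arguments powersum1 : clear implicits.
Arguments powersum : clear implicits.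

(* Main.v *)
Require Import Defs.
From mathcomp Require Import all_boot all_order all_algebra.
From mathcomp Require Import fingroup perm zify ring.
From mathcomp Require Import finmap.
From mathcomp Require Import all_classical all_reals all_analysis.
Set Implicit Arguments.
Unset Strict Implicit.
Unset Printing Implicit Defensive.
Import Order.TTheory GRing.Theory Num.Theory.
Import numFieldNormedType.Exports.
Local Open Scope classical_set_scope.
Local Open Scope ring_scope.

(* Both sides have coefficient [\prod_r h (m r)] at the monomial [m], where [h]
   is the sequence of extended complete symmetric functions.
   On the left, the horizontal strips of equal entries of a tableau and the
   Pieri rule for Jacobi-Trudi determinants of an arbitrary sequence [h] with
   [h 0 = 1] add one variable at a time.
   On the right, [x_r d/dx_r] turns the sum over partitions into the recursion
   [m_r E_m = \sum_k p_k E_(m - k e_r)], where [e_r] is the exponent vector of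
   [x_r]. Newton's identities [k h_k = \sum_i p_i h_(k-i)] give the product the
   same recursion; they hold for the partial products and pass to the limit. *)

(** * Jacobi-Trudi determinants and the Pieri rule *)

(** Both sides are compared at one monomial at a time. It involves only variables of index below
    some [N], so every sum becomes finite. Keeping [h] arbitrary avoids specializing a ring of
    symmetric functions. A new letter opens at most one new row, which matches the passage from
    determinants of size [n] to size [n.+1] in the Pieri rule; this is why tableaux in [N] letters
    are carried with exactly [N] rows, and [h 0 = 1] makes the empty rows harmless. On the power sum
    side the recursion determines the coefficient after division by [m_r], so the induction on the
    degree picks a variable that occurs in the monomial. The limits that define [h] are not known to
    exist beforehand. Newton's identities for the partial products, solved for the top coefficient,
    express it through power sums and lower coefficients, so its convergence reduces to that of the
    power sums. *)

Section JacobiTrudi.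
Variables (R : comNzRingType) (h : nat -> R).

(** Stands for [h] at the integer [a - b]. Truncated subtraction alone would give [h 0] at negative
    indices, hence the test. *)
Definition hdiff (a b : nat) : R := if (b <= a)%N then h (a - b)%N else 0.

(** The size [n] is independent of [l], so that a list can be read as padded with zero parts. *)
Definition jacobi_trudi (n : nat) (l : seq nat) : R :=
  \det (\matrix_(i < n, j < n) hdiff (nth 0%N l i + j) i).

Lemma hdiffD a b c : hdiff (a + c) (b + c) = hdiff a b.
Proof. by rewrite /hdiff leq_add2r subnDr. Qed.

(** These interlacing inequalities say that [l/mu] is a horizontal strip, where [l] has one part
    more than [mu]. *)
Definition strip (mu l : seq nat) : bool :=
  all (fun i => nth 0 l i.+1 <= nth 0 mu i <= nth 0 l i)%N
      (iota 0 (size mu)).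

Definition seq_of_ffun (n L : nat) (f : {ffun 'I_n -> 'I_L}) : seq nat :=
  [seq val (f i) | i <- enum 'I_n].

Lemma size_seq_of_ffun n L (f : {ffun 'I_n -> 'I_L}) :
  size (seq_of_ffun f) = n.
Proof. by rewrite size_map size_enum_ord. Qed.

Lemma nth_seq_of_ffun n L (f : {ffun 'I_n -> 'I_L}) (i : 'I_n) :
  nth 0%N (seq_of_ffun f) i = f i.
Proof.
rewrite (nth_map i) ?size_enum_ord ?ltn_ord //; congr (val (f _)).
by rewrite nth_ord_enum.
Qed.

Lemma sumn_seq_of_ffun n L (f : {ffun 'I_n -> 'I_L}) :
  sumn (seq_of_ffun f) = (\sum_(i < n) f i)%N.
Proof. by rewrite sumnE big_map big_enum. Qed.

(* The rows of the matrices below are generating functions of the shifted parts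
   [b = l_i + n - i]; [L] bounds the parts of [l]. *)
Section Pieri.
Variables (mu : seq nat) (L : nat).
Let n := size mu.

(** In terms of the shifted parts, [mu_i <= l_i <= mu_(i-1)] says that [b] lies in the half-open
    range from [bound i.+1] to [bound i]. For [i = 0] the missing upper neighbour is replaced by
    [l_0 < L]. *)
Let bound (i : nat) : nat :=
  if i is i'.+1 then (nth 0 mu i' + (n - i'))%N else (L + n)%N.

Let part_sum (a j : nat) : {poly R} :=
  \sum_(0 <= b < a) 'X^b * (hdiff (b + j) n)%:P.

(** The difference telescopes; the boundary term at [b = 0] has the negative index [j - n] and
    vanishes. *)
Let part_sum_col a j : (j < n)%N ->
  part_sum a j - 'X * part_sum a j.+1 = - ('X^a * (hdiff (a + j) n)%:P).
Proof.
move=> jn; rewrite /part_sum mulr_sumr -sumrB.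
under eq_bigr => b _ do rewrite mulrA -exprS addnS -addSn -opprB.
rewrite sumrN telescope_sumr // expr0 mul1r add0n.
by rewrite {2}/hdiff leqNgt jn /= polyC0 subr0.
Qed.

(* Splitting the rows of [Dmx] gives the sum over strips; the column operations
   [T_j - 'X T_(j+1)] leave, up to a high power of ['X], the factor [h_k] times
   the determinant of [mu]. *)
Let Tmx : 'M[{poly R}]_n.+1 := \matrix_(i, j) part_sum (bound i) j.

Let Dmx : 'M[{poly R}]_n.+1 :=
  \matrix_(i, j) (part_sum (bound i) j - part_sum (bound i.+1) j).

(** Subtracting from each row the next one is multiplication by the unitriangular [B]. The last row
    has no successor, in accordance with [bound n.+1 = 0]. *)
Let det_Dmx : \det Dmx = \det Tmx.
Proof.
pose B : 'M[{poly R}]_n.+1 :=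
  \matrix_(i, j) ((i == j)%:R - (i.+1 == j :> nat)%:R).
have -> : Dmx = B *m Tmx.
  apply/matrixP => i j; rewrite !mxE.
  under eq_bigr => k _ do rewrite !mxE mulrBl.
  rewrite sumrB (bigD1 i) //= eqxx mul1r big1 ?addr0; last first.
    by move=> k; rewrite eq_sym => /negPf ->; rewrite mul0r.
  congr (_ - _).
  have [lt_in|le_ni] := ltnP i.+1 n.+1.
    rewrite (bigD1 (Ordinal lt_in)) //= eqxx mul1r big1 ?addr0 //.
    move=> k; rewrite -val_eqE eq_sym => /= /negPf ->; exact: mul0r.
  have -> : (i : nat) = n by apply/eqP; rewrite eqn_leq -ltnS ltn_ord.
  rewrite /part_sum /= nth_default // subnn big_geq // big1 // => k _.
  by rewrite gtn_eqF ?mul0r.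
rewrite det_mulmx -[\det B]det_tr det_trig.
  rewrite big1 ?mul1r // => i _; rewrite !mxE eqxx.
  by rewrite gtn_eqF ?subr0.
apply/is_trig_mxP => i j lt_ij; rewrite !mxE -val_eqE /=.
by rewrite !gtn_eqF ?subr0 // ltnW.
Qed.

Let det_Tmx k : (k < L + n)%N ->
  (\det Tmx)`_k =
  ('X^(\sum_(i < n) (nth 0%N mu i + (n - i))) *
   (jacobi_trudi n mu)%:P * \poly_(b < L + n) h b)`_k.
Proof.
move=> kL.
pose C : 'M[{poly R}]_n.+1 :=
  \matrix_(i, j) ((i == j)%:R - (i == j.+1 :> nat)%:R * 'X).
have detC : \det C = 1.
  rewrite det_trig ?big1 // => [i _|]; last first.
    apply/is_trig_mxP => i j lt_ij; rewrite !mxE -val_eqE /=.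
    by rewrite !ltn_eqF ?mul0r ?subr0 // ltnW.
  by rewrite !mxE eqxx ltn_eqF ?mul0r ?subr0.
have TC i j : (Tmx *m C) i j = if (j < n)%N
    then - ('X^(bound i) * (hdiff (bound i + j) n)%:P)
    else part_sum (bound i) n.
  rewrite !mxE; under eq_bigr => k' _ do rewrite !mxE mulrBr.
  rewrite sumrB (bigD1 j) //= eqxx mulr1 big1 ?addr0; last first.
    by move=> k' /negPf ->; rewrite mulr0.
  case: ltnP => [lt_jn | le_nj].
    rewrite -part_sum_col //; congr (_ - _).
    rewrite (bigD1 (Ordinal (lt_jn : j.+1 < n.+1)%N)) //= eqxx mul1r.
    rewrite big1 ?addr0 1?mulrC //.
    by move=> k'; rewrite -val_eqE => /= /negPf ->; rewrite mul0r mulr0.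
  have -> : (j : nat) = n by apply/eqP; rewrite eqn_leq -ltnS ltn_ord.
  rewrite big1 ?subr0 // => k' _.
  by rewrite ltn_eqF ?mul0r ?mulr0.
have -> : \det Tmx = \det (Tmx *m C) by rewrite det_mulmx detC mulr1.
(* In row 0 all entries but the last are multiples of ['X^(L + n)]. Below that degree only the last
   entry, a truncated generating function of [h], and its cofactor count. *)
rewrite (expand_det_row _ ord0) big_ord_recr coefD coef_sum big1 => [|j _].
  rewrite add0r TC ltnn /=; congr ((polyseq _)`_k).
  rewrite [LHS]mulrC; congr (_ * _); last first.
    rewrite /part_sum poly_def big_mkord; apply: eq_bigr => b _.
    by rewrite mulrC mul_polyC /hdiff leq_addl addnK.
  rewrite /cofactor.
  have -> : row' ord0 (col' ord_max (Tmx *m C)) =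
    diag_mx (\row_(i < n) 'X^(nth 0%N mu i + (n - i))) *m
    (- map_mx polyC (\matrix_(i < n, j < n) hdiff (nth 0%N mu i + j) i)).
    apply/matrixP => i j; rewrite mul_diag_mx !mxE.
    move: (TC (lift ord0 i) (lift ord_max j)); rewrite !mxE => ->.
    rewrite lift_max ltn_ord mulrN; congr (- (_ * _%:P)) => /=.
    rewrite -(hdiffD (_ + j) i (n - i)%N) addnAC.
    by congr hdiff; rewrite subnKC // ltnW // (ltn_ord i).
  rewrite det_mulmx det_diag -[- map_mx _ _]scaleN1r detZ det_map_mx add0n.
  (* The sign [(-1)^n] of the cofactor cancels the one from the negated block of size [n]. *)
  rewrite mulrCA [X in _ * X]mulrA -expr2 sqrr_sign mul1r.
  by congr (_ * _); rewrite -prodrXr; apply: eq_bigr => i _; rewrite mxE.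
rewrite TC /= ltn_ord -mulrN mulrAC -mulrA coefXnM /=.
by rewrite kL.
Qed.

Hypotheses (mu_sorted : sorted geq mu) (mu_L : (nth 0 mu 0 < L)%N).

Let det_Dmx_sum : \det Dmx =
  \sum_(f : {ffun 'I_n.+1 -> 'I_L} | strip mu (seq_of_ffun f))
    'X^(\sum_i (f i + (n - i))) * (jacobi_trudi n.+1 (seq_of_ffun f))%:P.
Proof.
pose P (i : 'I_n.+1) (l : 'I_L) := (bound i.+1 <= l + (n - i) < bound i)%N.
have bound_le (i : 'I_n.+1) : (bound i.+1 <= bound i)%N.
  case: i => -[|i] /= lt_in; last first.
    apply: leq_add; last exact: leq_sub2l.
    have [lt_iSn|le_niS] := ltnP i.+1 n; last by rewrite nth_default.
    by have /sortedP/(_ i lt_iSn) := mu_sorted; apply.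
  by rewrite subn0 leq_add2r ltnW.
have DmxE i j : Dmx i j =
    \sum_(l < L | P i l) 'X^(l + (n - i)) * (hdiff (l + (n - i) + j) n)%:P.
  pose F b := 'X^b * (hdiff (b + j) n)%:P.
  have -> : Dmx i j = \sum_(bound i.+1 <= b < bound i) F b.
    rewrite mxE; apply/eqP; rewrite subr_eq addrC; apply/eqP.
    exact: big_cat_nat.
  have bound_L : (bound i <= L + (n - i))%N.
    case: i => -[|i] /= lt_in; first by rewrite subn0.
    have : (nth 0 mu i < L)%N.
      apply: leq_ltn_trans mu_L.
      apply: (sorted_leq_nth (rev_trans leq_trans) leqnn 0%N mu_sorted) => //.
      by rewrite inE (leq_ltn_trans (leq0n i)).
    by move: lt_in; rewrite ltnS; lia.
  have n_bound : (0 + (n - i) <= bound i.+1)%N by rewrite leq_addl.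
  rewrite (big_nat_widen _ _ _ _ _ bound_L) (big_nat_widenl _ _ _ _ _ n_bound).
  rewrite big_addn addnK big_mkord; apply: eq_bigl => l.
  by rewrite /P andbC.
rewrite /determinant.
(* Multilinearity in the rows: one exponent is chosen in each row, and the choices allowed by [P]
   are exactly the strips. *)
transitivity (\sum_(s : 'S_n.+1) \sum_(f in family P) (-1) ^+ s *
   \prod_i ('X^(f i + (n - i)) * (hdiff (f i + (n - i) + s i) n)%:P)).
  apply: eq_bigr => s _; rewrite -mulr_sumr; congr (_ * _).
  under eq_bigr => i _ do rewrite DmxE.
  by rewrite bigA_distr_big_dep.
rewrite exchange_big; apply: eq_big => f /=.
  apply/familyP/allP => [fP i|st i].
    rewrite mem_iota => /= lt_in.
    have := fP (inord i.+1); have := fP (inord i).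
    rewrite /P !unfold_in /= -!nth_seq_of_ffun !inordK ?ltnS ?(ltnW lt_in) //.
    by move: lt_in; rewrite /bound; lia.
  have mu_le : (nth 0 mu i <= nth 0 (seq_of_ffun f) i)%N.
    have [lt_in|le_ni] := ltnP i n; last by rewrite nth_default.
    by have := st i; rewrite mem_iota lt_in => /(_ isT)/andP[].
  rewrite unfold_in /P -nth_seq_of_ffun leq_add2r mu_le.
  rewrite {mu_le} nth_seq_of_ffun; case: i => -[|i] /= lt_in.
    by rewrite subn0 ltn_add2r (ltn_ord (f _)).
  have lt_in' : (i < n)%N := lt_in.
  have := st i; rewrite mem_iota lt_in' => /(_ isT)/andP[].
  have -> : nth 0%N (seq_of_ffun f) i.+1 = f (Ordinal lt_in).
    by rewrite -nth_seq_of_ffun.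
  by move=> le_f _; rewrite -(subnSK lt_in') addnS ltnS leq_add2r.
move=> _; rewrite /jacobi_trudi /determinant rmorph_sum /= mulr_sumr.
apply: eq_bigr => s _.
rewrite big_split /= prodrXr mulrCA; congr (_ * _).
rewrite rmorphM rmorph_sign rmorph_prod /=; congr (_ * _).
apply: eq_bigr => i _; rewrite mxE nth_seq_of_ffun addnAC.
rewrite -(hdiffD (_ + _) i (n - i)%N); congr (hdiff _ _)%:P.
by rewrite subnKC // -ltnS.
Qed.

Lemma pieri_ffun k : (sumn mu + k + \sum_(i < n.+1) (n - i) < L)%N ->
  h k * jacobi_trudi n mu =
  \sum_(f : {ffun 'I_n.+1 -> 'I_L} |
      strip mu (seq_of_ffun f) && (sumn (seq_of_ffun f) == sumn mu + k)%N)
    jacobi_trudi n.+1 (seq_of_ffun f).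
Proof.
(* The staircase [s] is the total shift of the parts, so strips of size [k] sit in degree
   [sumn mu + k + s]. The bound on [L] keeps this degree in the range of [det_Tmx]. *)
pose s := (\sum_(i < n.+1) (n - i))%N => ltL.
have := det_Tmx (k := (sumn mu + k + s)%N).
have -> : (\sum_(i < n) (nth 0 mu i + (n - i)) = sumn mu + s)%N.
  rewrite big_split /= /s big_ord_recr /= subnn addn0; congr addn.
  by rewrite sumnE (big_nth 0%N) big_mkord.
rewrite -det_Dmx det_Dmx_sum => /(_ (ltn_addr _ ltL)).
rewrite -mulrA coefXnM ltn_add2r ltnNge leq_addr /=.
rewrite subnDr addKn coefCM coef_poly ifT; last first.
  by apply: leq_ltn_trans (ltn_addr _ ltL); rewrite -addnA addnCA leq_addr.
rewrite mulrC => <-; rewrite coef_sum big_mkcondr; apply: eq_bigr => f _.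
rewrite coefMC coefXn big_split /= -/s sumn_seq_of_ffun eqn_add2r eq_sym.
by case: eqP; rewrite ?mul1r ?mul0r.
Qed.

End Pieri.

(** [L] is the least value allowed by [pieri_ffun]. It excludes no strip, since every part is at
    most the sum [sumn mu + k]. *)
Definition strips (mu : seq nat) (k : nat) : seq (seq nat) :=
  let n := size mu in
  let L := (sumn mu + k + \sum_(i < n.+1) (n - i)).+1 in
  [seq seq_of_ffun f | f <- enum {ffun 'I_n.+1 -> 'I_L}
     & strip mu (seq_of_ffun f) && (sumn (seq_of_ffun f) == sumn mu + k)%N].

Lemma leq_nth_sumn (s : seq nat) i : (nth 0 s i <= sumn s)%N.
Proof.
elim: s i => [|x s IH] [|i] //=; first exact: leq_addr.
exact: leq_trans (IH i) (leq_addl _ _).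
Qed.

Lemma mem_strips mu k l : (l \in strips mu k) =
  [&& size l == (size mu).+1, strip mu l & sumn l == (sumn mu + k)%N].
Proof.
apply/mapP/and3P => [[f + ->]|[/eqP sz st /eqP suml]].
  by rewrite mem_filter size_seq_of_ffun eqxx => /andP[/andP[-> ->]].
set L := (sumn mu + k + _).+1.
have lL i : (nth 0 l i < L)%N.
  by rewrite ltnS (leq_trans (leq_nth_sumn l i)) // suml leq_addr.
pose f := [ffun i : 'I_(size mu).+1 => Ordinal (lL i)].
have lE : l = seq_of_ffun f.
  apply: (@eq_from_nth _ 0%N) => [|i]; rewrite ?size_seq_of_ffun // sz => lt_i.
  by rewrite (nth_seq_of_ffun f (Ordinal lt_i)) ffunE.
by exists f => //; rewrite mem_filter -lE st suml eqxx mem_enum.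
Qed.

Lemma strips_uniq mu k : uniq (strips mu k).
Proof.
rewrite map_inj_uniq => [|f g eq_fg]; first by rewrite filter_uniq ?enum_uniq.
by apply/ffunP => i; apply: val_inj; rewrite /= -!nth_seq_of_ffun eq_fg.
Qed.

Lemma pieri mu k : sorted geq mu ->
  h k * jacobi_trudi (size mu) mu =
  \sum_(l <- strips mu k) jacobi_trudi (size mu).+1 l.
Proof.
move=> mu_sorted; rewrite big_map big_filter big_enum_cond.
apply: pieri_ffun => //; rewrite ltnS -addnA.
exact: leq_trans (leq_nth_sumn _ _) (leq_addr _ _).
Qed.

(** A trailing zero part makes the last row [(0, ..., 0, h 0)]; the determinant is expanded along
    it. *)
Lemma jacobi_trudi_pad n l : h 0%N = 1 -> (size l <= n)%N ->
  jacobi_trudi n l = jacobi_trudi (size l) l.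
Proof.
move=> h0; elim: n => [|n IH]; first by rewrite leqn0 => /eqP ->.
rewrite leq_eqVlt ltnS => /predU1P[-> // | le_ln]; rewrite -IH //.
rewrite /jacobi_trudi (expand_det_row _ ord_max) big_ord_recr /= big1 => [|j _].
  rewrite mxE nth_default //= /hdiff leqnn subnn h0 mul1r add0r.
  rewrite /cofactor addnn -mul2n exprM sqrrN !expr1n mul1r; congr (\det _).
  by apply/matrixP => i j; rewrite !mxE !lift_max.
by rewrite mxE nth_default //= /hdiff leqNgt ltn_ord mul0r.
Qed.

End JacobiTrudi.

(** * Tableaux built strip by strip *)

Definition column_strict (up down : seq nat) : bool :=
  all (fun p : nat * nat => (p.1 < p.2)%N) (zip up down).

Lemma column_strictP (up down : seq nat) : (size down <= size up)%N ->
  reflect (forall j, (j < size down)%N -> (nth 0 up j < nth 0 down j)%N)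
    (column_strict up down).
Proof.
move=> le_du; apply: (iffP (all_nthP (0, 0)%N)) => H j lt_j.
  have lt_jz : (j < size (zip up down))%N by rewrite size_zip (minn_idPr le_du).
  by have := H j lt_jz; rewrite nth_zip_cond lt_jz.
rewrite nth_zip_cond lt_j /=; apply: H.
by move: lt_j; rewrite size_zip (minn_idPr le_du).
Qed.

Lemma nth_shape (S : Type) (T : seq (seq S)) i :
  nth 0%N (shape T) i = size (nth [::] T i).
Proof.
have [lt_iT|le_Ti] := ltnP i (size T); first by rewrite (nth_map [::]).
by rewrite !nth_default ?size_map.
Qed.

(* A tableau in [N] letters is padded with empty rows to exactly [N] rows, and
   rows beyond the last one count as empty. *)
Definition is_tableau (N : nat) (T : seq (seq nat)) : Prop :=
  size T = N /\
  forall i, let up := nth [::] T i in let down := nth [::] T i.+1 in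
    [/\ (size down <= size up)%N, sorted leq up, column_strict up down
      & all (gtn N) up].

(** Entries grow by at least one per row down a column. Together with the bound on the letters, this
    limits the number of nonempty rows. *)
Lemma tableau_entry_ge N T i j : is_tableau N T ->
  (j < size (nth [::] T i))%N -> (i <= nth 0 (nth [::] T i) j)%N.
Proof.
move=> [_ tabT]; elim: i => // i IH lt_j.
have [le_sz _ /(column_strictP le_sz) col _] := tabT i.
exact: leq_ltn_trans (IH (leq_trans lt_j le_sz)) (col j lt_j).
Qed.

(** Dropping the last of [N.+1] rows is safe: its entries are at least [N], so they all equal the
    removed letter [N]. *)
Definition tableau_restrict (N : nat) (T : seq (seq nat)) : seq (seq nat) :=
  [seq [seq x <- row | (x < N)%N] | row <- take N T].

Definition tableau_extend (N : nat) (T : seq (seq nat)) (l : seq nat) :=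
  [seq p.1 ++ nseq (p.2 - size p.1) N | p <- zip (rcons T [::]) l].

Lemma nth_tableau_restrict N T i : is_tableau N.+1 T ->
  nth [::] (tableau_restrict N T) i = [seq x <- nth [::] T i | (x < N)%N].
Proof.
move=> tabT; have [szT rowT] := tabT.
have [lt_iN|le_Ni] := ltnP i N.
  rewrite (nth_map [::]) ?size_take ?szT ?ltnSn // nth_take //.
rewrite nth_default ?size_map ?size_take ?szT ?ltnSn //.
apply/esym/eqP; rewrite -(negbK (_ == _)) -has_filter -all_predC.
apply/(all_nthP 0%N) => j lt_j /=; rewrite -leqNgt.
exact: leq_trans le_Ni (tableau_entry_ge tabT lt_j).
Qed.

Lemma flatten_tableau_restrict N T : is_tableau N.+1 T ->
  flatten (tableau_restrict N T) = [seq x <- flatten T | (x < N)%N].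
Proof.
move=> tabT; have [szT rowT] := tabT.
rewrite filter_flatten -{2}(cat_take_drop N T) map_cat flatten_cat.
rewrite (drop_nth [::]) ?szT // drop_oversize ?szT //= cats0.
by rewrite -(nth_tableau_restrict _ tabT) nth_default ?cats0 // size_map
  size_take szT ltnSn.
Qed.

Lemma sorted_cat_nseq N k (s : seq nat) :
  sorted leq s -> all (gtn N) s -> sorted leq (s ++ nseq k N).
Proof.
rewrite !(sorted_pairwise leq_trans) pairwise_cat => -> /allP lt_s /=.
apply/andP; split; last by elim: k => //= k ->; rewrite all_nseq leqnn orbT.
by apply/allrelP => x y /lt_s /ltnW le_x; rewrite mem_nseq => /andP[_ /eqP ->].
Qed.

Section Extend.
Variables (N : nat) (T : seq (seq nat)) (l : seq nat).
Hypotheses (tabT : is_tableau N T) (sz_l : size l = N.+1).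
Hypothesis strip_l : strip (shape T) l.

Let le_strip i : (nth 0 l i.+1 <= size (nth [::] T i) <= nth 0 l i)%N.
Proof.
have [szT _] := tabT.
have [lt_iN|le_Ni] := ltnP i N; last first.
  by rewrite (@nth_default _ 0%N l) ?sz_l // nth_default ?szT.
have /allP/(_ i) := strip_l; rewrite mem_iota size_map szT => /(_ lt_iN).
by rewrite nth_shape.
Qed.

Lemma nth_tableau_extend i : nth [::] (tableau_extend N T l) i =
  nth [::] T i ++ nseq (nth 0 l i - size (nth [::] T i))%N N.
Proof.
have [szT _] := tabT.
have sz_zip : size (zip (rcons T [::]) l) = N.+1.
  by rewrite size_zip size_rcons szT sz_l minnn.
have [lt_iN|le_Ni] := ltnP i N.+1; last first.
  by rewrite !nth_default ?size_map ?sz_zip ?sz_l ?szT // ltnW.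
rewrite (nth_map ([::], 0%N)) ?sz_zip // nth_zip ?size_rcons ?szT ?sz_l //=.
rewrite nth_rcons szT; move: lt_iN; rewrite ltnS leq_eqVlt.
case/predU1P => [->|lt_iN]; last by rewrite lt_iN.
by rewrite ltnn eqxx (nth_default [::]) ?szT.
Qed.

Let size_row i : size (nth [::] (tableau_extend N T l) i) = nth 0%N l i.
Proof.
rewrite nth_tableau_extend size_cat size_nseq subnKC //.
by case/andP: (le_strip i).
Qed.

Lemma shape_tableau_extend : shape (tableau_extend N T l) = l.
Proof.
have sz : size (tableau_extend N T l) = N.+1.
  by rewrite size_map size_zip size_rcons (tabT.1) sz_l minnn.
apply: (@eq_from_nth _ 0%N) => [|i]; rewrite size_map sz ?sz_l // => lt_i.
by rewrite (nth_map [::]) ?sz.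
Qed.

Lemma tableau_extendP : is_tableau N.+1 (tableau_extend N T l).
Proof.
split=> [|i]; first by rewrite size_map size_zip size_rcons (tabT.1) sz_l minnn.
have [le_sz srt col lt_N] := tabT.2 i.
have /andP[le1 le2] := le_strip i.
have le_row : (size (nth [::] (tableau_extend N T l) i.+1) <=
    size (nth [::] (tableau_extend N T l) i))%N.
  by rewrite !size_row (leq_trans le1).
split=> //.
- by rewrite nth_tableau_extend sorted_cat_nseq.
(* By the strip condition the cell above any cell of the next row already belongs to [T], so its
   letter is below [N] and no column receives [N] twice. *)
- apply/column_strictP => // j; rewrite size_row => lt_j.
  rewrite !nth_tableau_extend !nth_cat (leq_trans lt_j le1).
  case: (ltnP j) => lt_jd.
    exact: (elimT (column_strictP le_sz) col j lt_jd).
  rewrite nth_nseq ifT ?ltn_sub2r //; last exact: leq_ltn_trans lt_j.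
  by apply: (allP lt_N); rewrite mem_nth // (leq_trans lt_j le1).
- rewrite nth_tableau_extend all_cat all_nseq /= ltnSn orbT andbT.
  by apply: sub_all lt_N => x /= /ltnW.
Qed.

Lemma tableau_extendK : tableau_restrict N (tableau_extend N T l) = T.
Proof.
apply: (@eq_from_nth _ [::]) => [|i].
  rewrite size_map size_take size_map size_zip size_rcons (tabT.1) sz_l minnn.
  by rewrite ltnSn.
rewrite nth_tableau_restrict; last exact: tableau_extendP.
move=> _; rewrite nth_tableau_extend filter_cat.
rewrite (all_filterP _); last by have [] := tabT.2 i.
rewrite -[RHS]cats0; congr cat; apply/eqP.
by rewrite -(negbK (_ == _)) -has_filter has_nseq ltnn andbF.
Qed.

End Extend.

Lemma sorted_split_max N (s : seq nat) : sorted leq s -> all (gtn N.+1) s ->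
  s = [seq x <- s | (x < N)%N] ++
      nseq (size s - size [seq x <- s | (x < N)%N]) N.
Proof.
elim: s => //= x s IH srt /andP[lt_x lt_s].
have {IH} IH := IH (path_sorted srt) lt_s.
case: ifP => [lt_xN|/negbT]; first by rewrite /= subSS -IH.
rewrite -leqNgt => le_Nx.
have -> : x = N by apply/eqP; rewrite eqn_leq -ltnS lt_x.
have /order_path_min -/(_ leq_trans) /allP min_x := srt.
rewrite (_ : [seq y <- s | (y < N)%N] = [::]) /= in IH *.
  by rewrite subn0 in IH *; rewrite {1}IH.
apply/eqP; rewrite -(negbK (_ == _)) -has_filter -all_predC; apply/allP => y ys.
by rewrite /= -leqNgt (leq_trans le_Nx) ?min_x.
Qed.

Section Restrict.
Variables (N : nat) (T : seq (seq nat)).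
Hypothesis (tabT : is_tableau N.+1 T).

(** Otherwise some cell of row [i.+1] would lie under the maximal letter [N] and need a larger one.
    This is the nontrivial half of the strip condition. *)
Let le_row i : (size (nth [::] T i.+1) <=
  size [seq x <- nth [::] T i | (x < N)%N])%N.
Proof.
have [le_sz srt /(column_strictP le_sz) col lt_N] := tabT.2 i.
rewrite leqNgt; apply/negP => lt_sz.
have [_ _ _ /allP lt_N'] := tabT.2 i.+1.
have := lt_N' _ (mem_nth 0%N lt_sz); have := col _ lt_sz.
rewrite {1}(sorted_split_max srt lt_N) nth_cat ltnn subnn nth_nseq.
rewrite subn_gt0 (leq_trans lt_sz le_sz) => lt1 /=.
by rewrite ltnS leqNgt lt1.
Qed.

Lemma strip_tableau_restrict : strip (shape (tableau_restrict N T)) (shape T).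
Proof.
apply/allP => i _; rewrite !nth_shape nth_tableau_restrict // le_row.
by rewrite size_filter count_size.
Qed.

Lemma tableau_restrictP : is_tableau N (tableau_restrict N T).
Proof.
split=> [|i]; first by rewrite size_map size_take tabT.1 ltnSn.
rewrite !nth_tableau_restrict //.
have [le_sz srt /(column_strictP le_sz) col lt_N] := tabT.2 i.
have [_ srt' _ lt_N'] := tabT.2 i.+1.
have le_sz' : (size [seq x <- nth [::] T i.+1 | (x < N)%N] <=
    size [seq x <- nth [::] T i | (x < N)%N])%N.
  by apply: leq_trans (le_row i); rewrite size_filter count_size.
split=> //.
- exact: sorted_filter leq_trans _ _ srt.
- apply/column_strictP => // j lt_j.
  have split_i := sorted_split_max srt lt_N.
  have split_i' := sorted_split_max srt' lt_N'.
  have := col j; rewrite {1}split_i {2}split_i' !nth_cat lt_j.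
  rewrite (leq_trans lt_j le_sz'); apply; apply: leq_trans lt_j _.
  by rewrite size_filter count_size.
- exact: filter_all.
Qed.

Lemma tableau_restrictK : tableau_extend N (tableau_restrict N T) (shape T) = T.
Proof.
have szT := tabT.1.
have sz : size (shape T) = N.+1 by rewrite size_map.
apply: (@eq_from_nth _ [::]) => [|i _].
  by rewrite size_map size_zip size_rcons (tableau_restrictP.1) sz minnn.
rewrite nth_tableau_extend //; last exact: tableau_restrictP.
rewrite nth_tableau_restrict //.
have [_ srt _ lt_N] := tabT.2 i.
rewrite [RHS](sorted_split_max srt lt_N); by rewrite nth_shape.
Qed.

End Restrict.

(** A tableau of content [m] is a chain of shapes in which letter [r] adds a horizontal strip of
    [m r] cells; the recursion follows repeated use of the Pieri rule. *)
Fixpoint tableaux (m : nat -> nat) (N : nat) : seq (seq (seq nat)) :=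
  if N is N'.+1 then
    [seq tableau_extend N' T l | T <- tableaux m N',
                                 l <- strips (shape T) (m N')]
  else [:: [::]].

Lemma sumn_shape_tableau N T : is_tableau N.+1 T ->
  sumn (shape T) =
  (sumn (shape (tableau_restrict N T)) + count_mem N (flatten T))%N.
Proof.
move=> tabT; rewrite -!size_flatten flatten_tableau_restrict // size_filter.
rewrite -(count_predC (fun x => x < N)%N); congr addn.
apply: eq_in_count => x /flattenP[row /(nthP [::])[i _ <-] x_row] /=.
have [_ _ _ /allP/(_ x x_row)/=] := tabT.2 i.
by rewrite ltnS -leqNgt eqn_leq => ->.
Qed.

Lemma mem_tableaux m N T : T \in tableaux m N <->
  is_tableau N T /\ (forall r, (r < N)%N -> count_mem r (flatten T) = m r).
Proof.
elim: N T => [|N IH] T /=.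
  rewrite inE; split=> [/eqP ->|[[/size0nil ->]]] //.
  by split=> //; split=> // i; rewrite !nth_default.
split=> [/allpairsPdep[T0 [l [/IH[tabT0 cntT0] + ->]]]|[tabT cntT]].
  rewrite mem_strips size_map tabT0.1 => /and3P[/eqP sz st /eqP sum].
  have tabT := tableau_extendP tabT0 sz st; split=> // r.
  rewrite ltnS leq_eqVlt => /predU1P[->|lt_rN].
    have := sumn_shape_tableau tabT.
    by rewrite shape_tableau_extend // tableau_extendK // sum => /addnI.
  rewrite -cntT0 // -[in RHS](tableau_extendK tabT0 sz st).
  rewrite flatten_tableau_restrict // count_filter; apply: eq_count => x /=.
  by case: eqP => // ->.
apply/allpairsPdep; exists (tableau_restrict N T), (shape T).
rewrite tableau_restrictK //; split=> //.
  apply/IH; split=> [|r lt_rN]; first exact: tableau_restrictP.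
  rewrite -(cntT _ (leqW lt_rN)) flatten_tableau_restrict // count_filter.
  by apply: eq_count => x /=; case: eqP => // ->.
rewrite mem_strips strip_tableau_restrict // !size_map size_take tabT.1 ltnSn.
by rewrite eqxx (sumn_shape_tableau tabT) cntT /=.
Qed.

Lemma tableaux_uniq m N : uniq (tableaux m N).
Proof.
elim: N => //= N IH; apply: allpairs_uniq_dep => // [T _|].
  exact: strips_uniq.
move=> [T l] [T' l'] /allpairsPdep[T1 [l1 [/mem_tableaux[tab1 _] st1 [-> ->]]]].
move=> /allpairsPdep[T2 [l2 [/mem_tableaux[tab2 _] st2 [-> ->]]]] /= eq12.
move: st1 st2; rewrite !mem_strips !size_map tab1.1 tab2.1.
move=> /and3P[/eqP sz1 st1 _] /and3P[/eqP sz2 st2 _].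
have eqT : T1 = T2.
  by rewrite -(tableau_extendK tab1 sz1 st1) eq12 tableau_extendK.
have eql : l1 = l2.
  by rewrite -(shape_tableau_extend tab1 sz1 st1) eq12 shape_tableau_extend.
by rewrite eqT eql.
Qed.

(** For a fixed restriction [T], the sum over its extensions by the letter [N] is one application of
    [pieri] and yields the factor [h (m N)]. *)
Lemma sum_tableaux (R : comNzRingType) (h : nat -> R) m N :
  \sum_(T <- tableaux m N) jacobi_trudi h N (shape T) = \prod_(r < N) h (m r).
Proof.
elim: N => [|N IH]; first by rewrite big_ord0 big_seq1 /jacobi_trudi det_mx00.
rewrite big_ord_recr /= -IH mulr_suml big_allpairs_dep /=.
rewrite big_seq [RHS]big_seq; apply: eq_bigr => T /mem_tableaux[tabT _].
have sz : size (shape T) = N by rewrite size_map tabT.1.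
rewrite mulrC -[X in jacobi_trudi _ X _]sz pieri.
  rewrite sz big_seq [RHS]big_seq; apply: eq_bigr => l.
  rewrite mem_strips sz => /and3P[/eqP szl st _].
  by rewrite shape_tableau_extend.
by apply/(sortedP 0%N) => i _; rewrite !nth_shape; have [] := tabT.2 i.
Qed.

(** * Newton's identities for the extended functions *)

Section NewtonIdentities.
Variable R : realType.
Implicit Types p q f g : R^nat.

(** A coefficient of a Cauchy product depends only on truncations, so ring laws can be borrowed from
    polynomials. *)
Lemma zser_mul_poly K f g k : (k < K)%N ->
  zser_mul f g k = ((\poly_(i < K) f i) * (\poly_(i < K) g i))`_k.
Proof.
move=> lt_kK; rewrite coefM; apply: eq_bigr => i _.
rewrite !coef_poly (leq_ltn_trans (leq_subr _ _) lt_kK).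
by rewrite (leq_ltn_trans _ lt_kK) // -ltnS.
Qed.

Lemma zser_mulC f g : zser_mul f g = zser_mul g f.
Proof.
by apply/funext => k; rewrite !(zser_mul_poly _ _ (ltnSn k)) mulrC.
Qed.

Lemma zser_mulA f g h :
  zser_mul f (zser_mul g h) = zser_mul (zser_mul f g) h.
Proof.
apply/funext => k; transitivity
  ((\poly_(i < k.+1) f i * (\poly_(i < k.+1) g i * \poly_(i < k.+1) h i))`_k).
  rewrite coefM; apply: eq_bigr => i _.
  by rewrite coef_poly ltn_ord (zser_mul_poly (K := k.+1)) // ltnS leq_subr.
rewrite mulrA coefM; apply: eq_bigr => i _.
by rewrite (zser_mul_poly (K := k.+1)) // coef_poly ltnS leq_subr.
Qed.

(* [z f'(z) = p(z) f(z)], that is, [p] is [z] times the logarithmic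
   derivative of [f]. *)
Definition newton p f : Prop := forall k, f k *+ k = zser_mul p f k.

(** Logarithmic derivatives add: in each term of the Cauchy product the factor [k] splits as
    [i + (k - i)]. *)
Lemma newtonM p q f g : newton p f -> newton q g ->
  newton (fun k => p k + q k) (zser_mul f g).
Proof.
move=> pf qg k.
transitivity (zser_mul (zser_mul p f) g k + zser_mul f (zser_mul q g) k).
  rewrite -big_split -sumrMnl; apply: eq_bigr => i _ /=.
  rewrite -pf -qg mulrnAl mulrnAr -mulrnDr subnKC //.
  by rewrite -ltnS.
rewrite [zser_mul q g]zser_mulC zser_mulA [_ (_ f g) q]zser_mulC -zser_mulA.
by rewrite -big_split; apply: eq_bigr => i _; rewrite /= mulrDl.
Qed.

Lemma newton_prod n (p : nat -> R^nat) (F : nat -> R^nat) :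
  (forall i, newton (p i) (F i)) ->
  newton (fun k => \sum_(i < n) p i k)
    (\big[@zser_mul R/@zser_one R]_(i < n) F i).
Proof.
elim: n p F => [|n IH] p F pF k.
  rewrite big_ord0 /zser_mul big1 => [|i _]; last by rewrite big_ord0 mul0r.
  by case: k => // k; rewrite /zser_one mul0rn.
have /(_ k) := newtonM (pF 0%N) (IH _ _ (fun i => pF i.+1)).
rewrite big_ord_recl => ->; apply: eq_bigr => i _.
by rewrite big_ord_recl.
Qed.

Lemma newton_exp (c : R) :
  newton (fun k => if k == 1%N then c else 0) (exp_coeff c).
Proof.
case=> [|k]; first by rewrite mulr0n /zser_mul big_ord1 mul0r.
rewrite /zser_mul !big_ord_recl big1 => [|i _]; last by rewrite mul0r.
rewrite mul0r add0r addr0 subSS subn0 /exp_coeff /=.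
rewrite exprS factS natrM -mulr_natr; field.
by rewrite nat1r !pnatr_eq0 -lt0n fact_gt0.
Qed.

(** The logarithmic derivative here is [a z / (1 - a z)]. *)
Lemma newton_geometric (a : R) :
  newton (fun k => if k == 0%N then 0 else a ^+ k) (zser_geometric a).
Proof.
move=> k; rewrite /zser_mul big_ord_recl mul0r add0r /zser_geometric.
rewrite (eq_bigr (fun=> a ^+ k)) ?sumr_const ?card_ord // => i _.
by rewrite /= /bump leq0n add1n -exprD subnKC.
Qed.

(** The logarithmic derivative here is [b z / (1 + b z)]. *)
Lemma newton_linear (b : R) :
  newton (fun k => if k == 0%N then 0 else (-1) ^+ k.+1 * b ^+ k)
    (zser_linear b).
Proof.
case=> [|[|k]]; rewrite /zser_mul.
- by rewrite mulr0n big_ord1 mul0r.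
- by rewrite !big_ord_recl big_ord0 /zser_linear /= !mul0r add0r addr0 !mulr1
    !expr1 sqrrN expr1n mul1r.
(* From degree 2 on, only the last two terms of the Cauchy product survive, and they cancel. *)
rewrite /zser_linear /= mul0rn big_ord_recr big_ord_recr /=.
rewrite big1 => [|i _]; last first.
  have : (1 < k.+2 - i)%N by rewrite ltn_subRL addn1 ltnS ltn_ord.
  by case: (k.+2 - i)%N => [|[|j]] //; rewrite mulr0.
rewrite subnn subSnn /= add0r mulr1 -mulrA -exprSr.
by rewrite [(-1) ^+ k.+3]exprS mulN1r mulNr subrr.
Qed.

End NewtonIdentities.

(** * Passage to the limit in Newton's identities *)

Section ExtendedLimits.
Variables (R : realType) (alpha beta : R^nat) (gamma : R).
Hypotheses (alpha_ge0 : forall i, 0 <= alpha i).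
Hypotheses (beta_ge0 : forall i, 0 <= beta i).
Hypotheses (alpha_cvg : cvgn (series alpha)) (beta_cvg : cvgn (series beta)).

Let partial_p (n : nat) : R^nat := fun k =>
  (if k == 1%N then gamma else 0) +
  \sum_(i < n) ((if k == 0%N then 0 else (-1) ^+ k.+1 * beta i ^+ k) +
                (if k == 0%N then 0 else alpha i ^+ k)).

Let newton_partial n :
  newton (partial_p n) (ext_gen_partial alpha beta gamma n).
Proof.
apply: newtonM; first exact: newton_exp.
exact: (newton_prod n (fun i =>
  newtonM (newton_linear (beta i)) (newton_geometric (alpha i)))).
Qed.

Lemma ext_gen_partial0 n : ext_gen_partial alpha beta gamma n 0%N = 1.
Proof.
rewrite /ext_gen_partial /zser_mul big_ord1 subnn /exp_coeff /= expr0 fact0.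
rewrite divr1 mul1r; elim/big_ind: _ => // [f g f0 g0|i _].
  by rewrite /zser_mul big_ord1 subnn f0 g0 mul1r.
by rewrite /zser_mul big_ord1 /= /zser_geometric expr0 mul1r.
Qed.

(** Each term is at most the sum [M], so the series is dominated by [M ^+ k] times the original
    one. *)
Lemma cvg_series_expr (u : R^nat) k : (forall i, 0 <= u i) ->
  cvgn (series u) -> cvgn (series (fun i => u i ^+ k.+1)).
Proof.
move=> u_ge0 u_cvg; set M := limn (series u).
have u_le i : u i <= M.
  apply: le_trans (nondecreasing_cvgn_le _ u_cvg i.+1).
    by rewrite /series /= big_nat_recr //= lerDr sumr_ge0.
  exact: nondecreasing_series.
apply: (@series_le_cvg _ _ (fun i => M ^+ k * u i)) => [i|i|i|].
- exact: exprn_ge0.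
- by rewrite mulr_ge0 // exprn_ge0 // (le_trans (u_ge0 0%N)).
- by rewrite exprSr ler_wpM2r // lerXn2r // nnegrE // (le_trans (u_ge0 0%N)).
- exact: is_cvg_seriesZ.
Qed.

Let cvg_partial_p k :
  partial_p n k.+1 @[n --> \oo] --> ext_p1 alpha beta gamma k.+1.
Proof.
have -> : (fun n => partial_p n k.+1) = (fun n =>
    (if k == 0%N then gamma else 0) +
    ((-1) ^+ k.+2 * series (fun i => beta i ^+ k.+1) n +
     series (fun i => alpha i ^+ k.+1) n)).
  apply/funext => n; rewrite /partial_p eqSS big_split /= -mulr_sumr.
  by rewrite /series /= !big_mkord.
have -> : ext_p1 alpha beta gamma k.+1 = (if k == 0%N then gamma else 0) +
    ((-1) ^+ k.+2 * limn (series (fun i => beta i ^+ k.+1)) +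
     limn (series (fun i => alpha i ^+ k.+1))).
  rewrite /ext_p1 eqSS; case: k => [|k] /=; last by rewrite add0r addrC.
  by rewrite sqrrN expr1n mul1r -addrA [X in _ + X]addrC;
    under [fun i => beta i ^+ 1]eq_fun do rewrite expr1.
apply: cvgD; first exact: cvg_cst.
apply: cvgD; last exact: cvg_series_expr.
apply: cvgM; [exact: cvg_cst|exact: cvg_series_expr].
Qed.

Let ext_gen_partialS n k : ext_gen_partial alpha beta gamma n k.+1 =
  k.+1%:R^-1 * \sum_(i < k.+1)
     partial_p n i.+1 * ext_gen_partial alpha beta gamma n (k - i)%N.
Proof.
have /(_ k.+1) := newton_partial n; rewrite /zser_mul big_ord_recl.
have -> : partial_p n 0%N = 0.
  by rewrite /partial_p add0r big1 // => i _; rewrite addr0.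
rewrite mul0r add0r => <-.
rewrite -[ext_gen_partial _ _ _ _ _ *+ _]mulr_natl mulrA.
by rewrite mulVf ?mul1r // pnatr_eq0.
Qed.

Let cvg_conv k :
  (forall j, (j <= k)%N ->
     cvgn (fun n => ext_gen_partial alpha beta gamma n j)) ->
  ext_gen_partial alpha beta gamma n k.+1 @[n --> \oo] -->
    k.+1%:R^-1 * \sum_(i < k.+1)
      ext_p1 alpha beta gamma i.+1 * ext_h_nat alpha beta gamma (k - i).
Proof.
move=> cvg_h; under eq_fun do rewrite ext_gen_partialS.
apply: cvgM; first exact: cvg_cst.
apply: cvg_big => [|i _]; first exact: add_continuous.
by apply: cvgM; [exact: cvg_partial_p|exact: cvg_h (leq_subr _ _)].
Qed.

(** Strong induction: the top coefficient is a finite sum of products of convergent power sums and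
    lower coefficients. *)
Lemma is_cvg_ext_gen_partial k :
  cvgn (fun n => ext_gen_partial alpha beta gamma n k).
Proof.
elim/ltn_ind: k => -[|k] IH.
  under eq_fun do rewrite ext_gen_partial0; exact: is_cvg_cst.
by apply: cvgP; apply: cvg_conv.
Qed.

Lemma ext_h_nat0 : ext_h_nat alpha beta gamma 0%N = 1.
Proof.
rewrite /ext_h_nat; under eq_fun do rewrite ext_gen_partial0.
exact: lim_cst.
Qed.

Lemma ext_h_nat_newton k : ext_h_nat alpha beta gamma k.+1 *+ k.+1 =
  \sum_(i < k.+1)
     ext_p1 alpha beta gamma i.+1 * ext_h_nat alpha beta gamma (k - i).
Proof.
have /cvg_lim := @cvg_conv k (fun j _ => @is_cvg_ext_gen_partial j).
rewrite -[limn _]/(ext_h_nat alpha beta gamma k.+1) => -> //.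
by rewrite -[(_ * _) *+ _]mulr_natl mulrA mulfV ?mul1r // pnatr_eq0.
Qed.

End ExtendedLimits.

(** * Power sums over partitions *)

(** A partition of [n] has at most [n] parts, each at most [n], so it occurs among these tuples.
    [undup] gives uniqueness outright. *)
Definition partitions_of (n : nat) : seq (seq nat) :=
  undup [seq l <- flatten [seq [seq map val (t : k.-tuple 'I_n.+1)
                                 | t <- enum {: k.-tuple 'I_n.+1}]
                            | k <- iota 0 n.+1]
        | is_partition l && (sumn l == n)].

Lemma partitions_of_uniq n : uniq (partitions_of n).
Proof. exact: undup_uniq. Qed.

Lemma size_leq_sumn (l : seq nat) : all (ltn 0) l -> (size l <= sumn l)%N.
Proof. by elim: l => //= x l IH /andP[x0 /IH]; lia. Qed.

Lemma leq_mem_sumn (l : seq nat) x : x \in l -> (x <= sumn l)%N.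
Proof.
elim: l => //= y l IH; rewrite inE => /predU1P[->|/IH]; first exact: leq_addr.
by move/leq_trans; apply; exact: leq_addl.
Qed.

Lemma mem_partitions_of n l :
  (l \in partitions_of n) = is_partition l && (sumn l == n).
Proof.
rewrite mem_undup mem_filter andb_idr // => /andP[/andP[_ l_gt0] /eqP suml].
have lt_n x : x \in l -> (x < n.+1)%N.
  by rewrite ltnS -suml; exact: leq_mem_sumn.
apply/flatten_mapP; exists (size l).
  by rewrite mem_iota /= add0n ltnS -suml size_leq_sumn.
have sz : size [seq inord x : 'I_n.+1 | x <- l] == size l by rewrite size_map.
apply/mapP; exists (Tuple sz); first by rewrite mem_enum.
rewrite /= -map_comp map_id_in // => x xl /=.
by rewrite inordK ?lt_n.
Qed.

Lemma partition_rem k l : is_partition l -> is_partition (rem k l).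
Proof.
move=> /andP[srt gt0]; apply/andP; split.
  exact: subseq_sorted (rev_trans leq_trans) _ _ (rem_subseq _ _) srt.
by apply/allP => x /mem_rem; exact: (allP gt0).
Qed.

Lemma sumn_rem k (l : seq nat) : k \in l -> sumn l = (k + sumn (rem k l))%N.
Proof. by move=> kl; rewrite (perm_sumn (perm_to_rem kl)). Qed.

Lemma partition_perm_eq l l' : is_partition l -> is_partition l' ->
  perm_eq l l' -> l = l'.
Proof.
move=> /andP[srt _] /andP[srt' _]; apply: sorted_eq srt srt'.
  exact: rev_trans leq_trans.
by move=> x y; rewrite andbC => /anti_leq.
Qed.

(** Deleting one part [k] is a bijection; its inverse inserts [k] and sorts. *)
Lemma perm_partitions_of_rem n k : (0 < k <= n)%N ->
  perm_eq [seq rem k l | l <- partitions_of n & k \in l]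
    (partitions_of (n - k)).
Proof.
move=> /andP[k_gt0 le_kn]; apply: uniq_perm; last 1 first.
- move=> mu; apply/mapP/idP => [[l]|].
    rewrite mem_filter !mem_partitions_of => /and3P[kl pl /eqP suml] ->.
    by rewrite partition_rem // -suml (sumn_rem kl) addKn eqxx.
  rewrite mem_partitions_of => /andP[pmu /eqP summu].
  have perm_l : perm_eq (sort geq (k :: mu)) (k :: mu).
    by rewrite perm_sort.
  have pl : is_partition (sort geq (k :: mu)).
    rewrite /is_partition sort_sorted => [|x y]; last exact: leq_total.
    by rewrite (perm_all _ perm_l) /= k_gt0; case/andP: pmu.
  have kl : k \in sort geq (k :: mu) by rewrite mem_sort mem_head.
  exists (sort geq (k :: mu)).
    rewrite mem_filter kl mem_partitions_of pl (perm_sumn perm_l) /= summu.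
    by rewrite subnKC.
  apply: partition_perm_eq => //; first exact: partition_rem.
  rewrite -(perm_cons k) perm_sym; apply: perm_trans perm_l.
  by rewrite perm_sym perm_to_rem.
- rewrite map_inj_in_uniq ?filter_uniq ?partitions_of_uniq // => l l'.
  rewrite !mem_filter !mem_partitions_of.
  move=> /and3P[kl pl _] /and3P[kl' pl' _] eq_rem.
  apply: partition_perm_eq => //; apply: perm_trans (perm_to_rem kl) _.
  by rewrite eq_rem perm_sym perm_to_rem.
- exact: partitions_of_uniq.
Qed.

(** The added factors are [0]-th powers times [0!]. A common range allows [z_part] of [l] and of
    [rem k l] to be compared factor by factor. *)
Lemma z_partE n l : all (ltn 0) l -> (sumn l <= n)%N -> z_part l =
  (\prod_(1 <= i < n.+1) (i ^ count_mem i l * (count_mem i l)`!))%N.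
Proof.
move=> l_gt0 le_n; rewrite [RHS](big_cat_nat (n := (sumn l).+1)) //=.
rewrite [X in (_ * X)%N]big_nat_cond [X in (_ * X)%N]big1 ?muln1 // => i.
case/andP=> /andP[lt_i _] _; rewrite (count_memPn _) //.
by apply/negP => /leq_mem_sumn; rewrite leqNgt lt_i.
Qed.

Lemma z_part_rem k l : all (ltn 0) l -> k \in l ->
  z_part l = (k * count_mem k l * z_part (rem k l))%N.
Proof.
move=> l_gt0 kl; have k_gt0 : (0 < k)%N := allP l_gt0 _ kl.
have le_k := leq_mem_sumn kl.
rewrite (z_partE l_gt0 (leqnn _)) (@z_partE (sumn l) (rem k l)); last 2 first.
- by apply/allP => x /mem_rem; exact: (allP l_gt0).
- by rewrite [X in (_ <= X)%N](sumn_rem kl) leq_addl.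
have k_in : k \in index_iota 1 (sumn l).+1 by rewrite mem_index_iota k_gt0 ltnS.
rewrite !(bigD1_seq _ k_in (iota_uniq _ _)) /= mulnA; congr (_ * _)%N.
  have := seq.permP (perm_to_rem kl) (pred1 k); rewrite /= eqxx add1n => ->.
  by rewrite expnS factS -!mulnA; congr (_ * _)%N; rewrite mulnCA.
apply: eq_bigr => i ne_ik.
have := seq.permP (perm_to_rem kl) (pred1 i).
by rewrite /= eq_sym (negPf ne_ik) add0n => ->.
Qed.

Lemma z_part_gt0 l : (0 < z_part l)%N.
Proof.
rewrite /z_part big_seq_cond prodn_cond_gt0 // => i.
rewrite andbT mem_index_iota => /andP[i_gt0 _].
by rewrite muln_gt0 expn_gt0 i_gt0 fact_gt0.
Qed.

(** * Monomials and the coefficients of power sum products *)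

Lemma mono_of_seqE s r : mono_of_seq s r = count_mem r s.
Proof.
rewrite /mono_of_seq fsfunE; case: ifP => // /negbT.
by rewrite seq_fsetE => /count_memPn ->.
Qed.

(** The quotient of [m] by [x_r^k], genuine only when [k <= m r]; the sums below carry that
    condition. *)
Definition mono_div (m : mono) (k r : nat) : mono :=
  [fsfun m with r |-> (m r - k)%N].

Lemma mono_divE m k r s :
  mono_div m k r s = if s == r then (m r - k)%N else m s.
Proof. exact: fsfun_withE. Qed.

Lemma mono_divC (m : mono) j k r s :
  mono_div (mono_div m k s) j r = mono_div (mono_div m j r) k s.
Proof.
apply/fsfunP => t; rewrite !mono_divE.
have [<-|ne_rs] := eqVneq r s; first by case: eqP => // _; exact: subnAC.
by case: (eqVneq t r) => [->|_]; rewrite ?eqxx ?[s == r]eq_sym ?(negPf ne_rs).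
Qed.

Definition mono_support (N : nat) (m : mono) : Prop :=
  forall r, (N <= r)%N -> m r = 0%N.

Lemma mono_support_exists m : exists N, mono_support N m.
Proof.
exists (\max_(r <- finsupp m) r).+1 => r le_r.
apply/eqP/negPn/negP => m_r; move: le_r; rewrite leqNgt ltnS => /negP; apply.
by rewrite (leq_bigmax_seq (F := fun i => i)) ?mem_finsupp.
Qed.

Lemma mono_support_div N m k r : mono_support N m ->
  mono_support N (mono_div m k r).
Proof.
by move=> m0 s /m0 ms; rewrite mono_divE; case: eqP => // <-; rewrite ms.
Qed.

Section PowerSums.
Variable R : realType.

Lemma powersum1_nseq k r : (0 < k)%N ->
  powersum1 R k (mono_of_seq (nseq k r)) = 1.
Proof.
move=> k_gt0; rewrite /powersum1 /fps_sum (fsbigE [:: r]) //=.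
- by rewrite big_mkcond big_seq1 /fps_mono eqxx in_setT.
- move=> s _; rewrite inE => ne_sr; rewrite /fps_mono; case: eqP => // eq_rs.
  have := congr1 (fun m : mono => m r) eq_rs.
  rewrite !mono_of_seqE !count_nseq /= eqxx (negPf ne_sr) mul1n mul0n => k0.
  by rewrite k0 in k_gt0.
Qed.

Lemma powersum1_neq0 k (m : mono) : powersum1 R k m != 0 ->
  exists r, m = mono_of_seq (nseq k r).
Proof.
rewrite /powersum1 /fps_sum.
move=> /(@fsbigN1 _ _ _ mono _ _ (fun m r => fps_mono R _ m))[r _].
by rewrite /fps_mono pnatr_eq0 eqb0 negbK => /eqP; exists r.
Qed.

(** A contributing factorization has [x_r^k] as its first factor, so it is determined by [r]; since
    [k > 0], this variable occurs in [m], whence [r < N]. *)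
Lemma fps_mul_powersum1 N k (g : fps R) m : (0 < k)%N -> mono_support N m ->
  fps_mul (powersum1 R k) g m = \sum_(r < N | (k <= m r)%N) g (mono_div m k r).
Proof.
move=> k_gt0 m_supp; rewrite /fps_mul.
pose F r := (mono_of_seq (nseq k r), mono_div m k r).
have F_ab r : (k <= m r)%N -> forall s, ((F r).1 s + (F r).2 s)%N = m s.
  move=> le_k s /=; rewrite mono_of_seqE count_nseq mono_divE /= eq_sym.
  by case: eqP => [->|_]; rewrite ?mul1n ?subnKC ?mul0n.
rewrite (fsbigE [seq F r | r <- iota 0 N & (k <= m r)%N]).
- rewrite big_map big_filter_cond.
  have -> : iota 0 N = index_iota 0 N by rewrite /index_iota subn0.
  rewrite big_mkord; apply: eq_big => [r|r /andP[le_k _]].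
    by apply: andb_idr => le_k; rewrite inE; exact: F_ab.
  by rewrite powersum1_nseq // mul1r.
- rewrite map_inj_uniq ?filter_uniq ?iota_uniq // => r s [eq_rs _].
  have := congr1 (fun m : mono => m r) eq_rs.
  rewrite !mono_of_seqE !count_nseq /= eqxx mul1n.
  by case: eqP => // _ k0; rewrite k0 in k_gt0.
- by move=> _ /mapP[r + ->]; rewrite mem_filter => /andP[le_k _]; exact: F_ab.
- move=> [a b] /= ab_m; apply: contraNeq; rewrite mulf_eq0 negb_or.
  move=> /andP[/powersum1_neq0[r ?] _]; subst a.
  have le_k : (k <= m r)%N.
    by rewrite -ab_m mono_of_seqE count_nseq /= eqxx mul1n leq_addr.
  apply/mapP; exists r.
    rewrite mem_filter le_k mem_iota /= add0n ltnNge.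
    by apply/negP => /m_supp m_r; rewrite m_r leqNgt k_gt0 in le_k.
  congr (_, _); apply/fsfunP => s; rewrite mono_divE.
  have := ab_m s; rewrite mono_of_seqE count_nseq /= eq_sym.
  by case: eqP => [->|_] <-; rewrite ?mul1n ?addKn.
Qed.

Lemma powersum_cons k l : powersum R (k :: l) =
  fps_mul (powersum1 R k) (powersum R l).
Proof. by rewrite /powersum big_cons. Qed.

Definition mono_deg N (m : mono) : nat := (\sum_(r < N) m r)%N.

Lemma mono_deg_div N (m : mono) k r : (r < N)%N -> (k <= m r)%N ->
  mono_deg N m = (k + mono_deg N (mono_div m k r))%N.
Proof.
move=> lt_r le_k; rewrite /mono_deg (bigD1 (Ordinal lt_r)) //=.
rewrite [in RHS](bigD1 (Ordinal lt_r)) //=.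
rewrite mono_divE eqxx.
rewrite addnA subnKC //; congr addn; apply: eq_bigr => i ne_ir.
by rewrite mono_divE -[r]/(val (Ordinal lt_r)) val_eqE (negPf ne_ir).
Qed.

Lemma powersum_neq0 N l m : all (ltn 0) l -> mono_support N m ->
  powersum R l m != 0 -> sumn l = mono_deg N m.
Proof.
elim: l m => [|k l IH] m /=.
  rewrite /powersum big_nil /fps_one /fps_mono => _ _.
  rewrite pnatr_eq0 eqb0 negbK => /eqP ->.
  by rewrite /mono_deg big1 // => r _; rewrite mono_of_seqE.
move=> /andP[k_gt0 l_gt0] m_supp.
rewrite powersum_cons (fps_mul_powersum1 _ k_gt0 m_supp).
have [/existsP[r /andP[le_k /IH eq_l]] _|] := boolP [exists r : 'I_N,
    (k <= m r)%N && (powersum R l (mono_div m k r) != 0)].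
  by rewrite (mono_deg_div (ltn_ord r) le_k) eq_l //; exact: mono_support_div.
rewrite negb_exists => /forallP H; rewrite big1 ?eqxx // => r le_k.
by have := H r; rewrite le_k negbK => /eqP.
Qed.

(** When [j = k], [rem] deletes the head instead; by sortedness the next entry is then also [k], and
    the two results agree. *)
Lemma rem_sorted_cons j k (l : seq nat) : sorted geq (k :: l) -> j \in l ->
  rem j (k :: l) = k :: rem j l.
Proof.
rewrite /=; case: eqP => // <-; case: l => //= x l /andP[le_xk srt].
rewrite inE => /predU1P[->|kl]; first by rewrite eqxx.
have : (k <= x)%N.
  by have /allP/(_ k kl) := order_path_min (rev_trans leq_trans) srt.
move=> le_kx; have -> : x = k by apply/eqP; rewrite eqn_leq le_kx andbT.
by rewrite eqxx.
Qed.

(** The Leibniz rule for [x_r d/dx_r], which multiplies the coefficient at [m] by [m r] and sends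
    [p_k] to [k x_r^k]. *)
Lemma powersum_euler N l m r : is_partition l -> mono_support N m ->
  (r < N)%N ->
  powersum R l m *+ m r =
  \sum_(k <- l) (if (k <= m r)%N
                 then powersum R (rem k l) (mono_div m k r) *+ k else 0).
Proof.
move=> + + lt_r; elim: l m => [|k l IH] m.
  move=> _ _; rewrite big_nil /powersum big_nil /fps_one /fps_mono.
  by case: eqP => [->|_]; rewrite ?mul0rn // mono_of_seqE.
move=> /andP[srt /= /andP[k_gt0 l_gt0]] m_supp.
have pl : is_partition l by rewrite /is_partition (path_sorted srt).
rewrite powersum_cons (fps_mul_powersum1 _ k_gt0 m_supp) big_cons /= eqxx.
rewrite -sumrMnl.
(* The exponent [m r] splits into what is left after division by [x_s^k] and, if [s = r], the
   removed [k]: these are the two terms of the Leibniz rule. *)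
transitivity (\sum_(s < N | (k <= m s)%N)
   (powersum R l (mono_div m k s) *+ mono_div m k s r +
    (if s == r :> nat then powersum R l (mono_div m k s) *+ k else 0))).
  apply: eq_bigr => s le_k; rewrite mono_divE eq_sym.
  by case: eqP => [<-|_]; rewrite ?addr0 // -mulrnDr subnK.
rewrite big_split addrC; congr (_ + _); last first.
  rewrite -big_mkcondr /=; case: ifP => [le_k|/negbT gt_k].
    rewrite (big_pred1 (Ordinal lt_r)) // => s.
    by apply/andP/eqP => [[_ /eqP eq_s]|->] //; apply: val_inj.
  by rewrite big1 // => s /andP[+ /eqP eq_s]; rewrite eq_s (negPf gt_k).
under eq_bigr => s _ do rewrite (IH _ pl (mono_support_div k s m_supp)).
rewrite exchange_big /=; rewrite big_seq [RHS]big_seq; apply: eq_bigr => j jl.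
have := rem_sorted_cons srt jl; rewrite /= => ->.
rewrite powersum_cons (fps_mul_powersum1 _ k_gt0 (mono_support_div _ _ m_supp)).
rewrite -big_mkcondr /=; case: (leqP j (m r)) => [le_j|gt_j].
  rewrite -sumrMnl; apply: eq_big => [s|s _]; last by rewrite mono_divC.
  by rewrite !mono_divE [r == _]eq_sym; case: eqP => [->|_]; lia.
rewrite big1 // => s; rewrite mono_divE => /andP[_].
by case: eqP => [<-|_] le_j; exfalso; lia.
Qed.

Variables (p h : nat -> R).

Definition powersum_weight (l : seq nat) : R :=
  (z_part l)%:R^-1 * \prod_(k <- l) p k.

(** By [z_part_rem], the factor [k] times the multiplicity of [k] turns [1 / z_l] into the weight of
    the partition with one [k] removed. *)
Lemma powersum_weight_rem k l : is_partition l -> k \in l ->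
  powersum_weight l *+ k *+ count_mem k l = p k * powersum_weight (rem k l).
Proof.
move=> /andP[_ l_gt0] kl; rewrite /powersum_weight (z_part_rem l_gt0 kl).
rewrite (perm_big _ (perm_to_rem kl)) big_cons /= -mulrnA.
rewrite -[(_ * _) *+ _]mulr_natr.
have k_neq0 : k%:R != 0 :> R by rewrite pnatr_eq0 -lt0n; exact: (allP l_gt0).
have count_neq0 : (count_mem k l)%:R != 0 :> R.
  by rewrite pnatr_eq0 -lt0n -has_count has_pred1.
have z_neq0 : (z_part (rem k l))%:R != 0 :> R.
  by rewrite pnatr_eq0 -lt0n z_part_gt0.
by rewrite !natrM; field; rewrite ?k_neq0 ?count_neq0 ?z_neq0.
Qed.

Lemma big_seq_count (F : nat -> R) M (l : seq nat) :
  (forall i, i \in l -> (0 < i)%N /\ ((M < i)%N -> F i = 0)) ->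
  \sum_(i <- l) F i = \sum_(i < M) F i.+1 *+ count_mem i.+1 l.
Proof.
elim: l => [|x l IH] Fl.
  by rewrite big_nil big1 // => i _; rewrite mulr0n.
rewrite big_cons IH => [|i il]; last by apply: Fl; rewrite inE il orbT.
under [RHS]eq_bigr => i _ do rewrite /= mulrnDr.
rewrite big_split /=; congr (_ + _).
have [x_gt0 Fx0] := Fl x (mem_head _ _).
have [lt_Mx|le_xM] := ltnP M x.
  rewrite Fx0 // big1 // => i _; case: eqP => // eq_x.
  by rewrite eq_x ltnNge ltn_ord in lt_Mx.
have lt_x : (x.-1 < M)%N by rewrite prednK.
rewrite (bigD1 (Ordinal lt_x)) //= prednK // eqxx big1 ?addr0 // => i ne_i.
case: eqP => // eq_x; case/negP: ne_i.
by rewrite -val_eqE /= eq_x.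
Qed.

Hypothesis h0 : h 0%N = 1.
Hypothesis h_newton : forall k,
  h k.+1 *+ k.+1 = \sum_(i < k.+1) p i.+1 * h (k - i)%N.

Lemma sum_powersum N m : mono_support N m ->
  \sum_(l <- partitions_of (mono_deg N m)) powersum_weight l * powersum R l m =
  \prod_(r < N) h (m r).
Proof.
move eq_d : (mono_deg N m) => d.
elim/ltn_ind: d => d IH in m eq_d *; move=> m_supp.
have [/existsP[r m_r]|] := boolP [exists r : 'I_N, m r != 0%N]; last first.
  rewrite negb_exists => /forallP m0.
  have {}m0 r : m r = 0%N.
    have [lt_r|/m_supp //] := ltnP r N.
    by apply/eqP; have := m0 (Ordinal lt_r); rewrite negbK.
  have d0 : d = 0%N by rewrite -eq_d /mono_deg big1.
  have -> : m = mono_of_seq [::] by apply/fsfunP => r; rewrite m0 mono_of_seqE.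
  rewrite d0 (perm_big [:: [::]]) /=; last first.
    apply: uniq_perm => // [|l]; first exact: partitions_of_uniq.
    rewrite mem_partitions_of inE; apply/idP/eqP => [|-> //].
    move=> /andP[/andP[_ /size_leq_sumn le_sz] /eqP sum_l].
    by apply/nilP; rewrite /nilp -leqn0 -sum_l.
  rewrite big_seq1 big1 => [|r _]; last by rewrite mono_of_seqE.
  rewrite /powersum_weight /z_part big_geq // !big_nil invr1 !mul1r.
  by rewrite /powersum big_nil /fps_one /fps_mono eqxx.
have m_r0 : (m r)%:R != 0 :> R by rewrite pnatr_eq0.
apply: (mulIf m_r0); rewrite !mulr_natr -sumrMnl.
transitivity (\sum_(k < m r) p k.+1 * \prod_(s < N) h (mono_div m k.+1 r s)).
  (* Equal parts are grouped. The factor [k] from the derivation and the multiplicity of the part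
     are absorbed into the weight. *)
  transitivity (\sum_(l <- partitions_of d) \sum_(k < m r | k.+1 \in l)
     p k.+1 * (powersum_weight (rem k.+1 l) *
     powersum R (rem k.+1 l) (mono_div m k.+1 r))).
    rewrite big_seq [RHS]big_seq; apply: eq_bigr => l.
    rewrite mem_partitions_of => /andP[pl _].
    rewrite -mulrnAr (powersum_euler pl m_supp) //.
    rewrite (big_seq_count (M := m r)); last first.
      move=> i il; split; first by have /andP[_ /allP/(_ _ il)] := pl.
      by rewrite ltnNge => /negPf ->.
    rewrite mulr_sumr [RHS]big_mkcond; apply: eq_bigr => k _.
    rewrite ltn_ord; case: ifPn => [kl|/count_memPn ->]; last first.
      by rewrite mulr0n mulr0.
    by rewrite [RHS]mulrA -(powersum_weight_rem pl kl) !mulrnAr !mulrnAl.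
  (* For fixed [k], removing one part turns the partitions of [d] that contain it into all
     partitions of the smaller degree, where the induction hypothesis applies. *)
  rewrite (exchange_big_dep xpredT) //=; apply: eq_bigr => k _.
  have le_k : (k.+1 <= m r)%N by [].
  have eq_dk := mono_deg_div (ltn_ord r) le_k.
  rewrite -(IH (d - k.+1)%N) //; last 3 first.
  - by rewrite -eq_d eq_dk; lia.
  - by rewrite -eq_d eq_dk addKn.
  - exact: mono_support_div.
  rewrite -(perm_big _ (perm_partitions_of_rem _)); last first.
    by rewrite -eq_d eq_dk leq_addr.
  by rewrite big_map big_filter mulr_sumr.
(* Newton's identity is applied to the factor [h (m r)] alone; division by a power of [x_r] leaves
   the other factors unchanged. *)
rewrite [in RHS](bigD1 r) //= -mulrnAl.
have := h_newton (m r).-1; rewrite prednK ?lt0n // => ->.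
rewrite mulr_suml; apply: eq_bigr => k _.
rewrite (bigD1 r) //= mono_divE eqxx -mulrA; congr (_ * (h _ * _)).
  by have := ltn_ord k; lia.
apply: eq_bigr => s ne_sr; rewrite mono_divE.
by rewrite val_eqE (negPf ne_sr).
Qed.

End PowerSums.

(** * Schur functions *)

(** A semistandard tableau of partition shape has no empty row, while [is_tableau N] asks for
    exactly [N] rows; [trim] and [pad] pass between the two. *)
Definition trim (T : seq (seq nat)) : seq (seq nat) :=
  [seq row <- T | row != [::]].

Definition pad (N : nat) (T : seq (seq nat)) : seq (seq nat) :=
  T ++ nseq (N - size T) [::].

Lemma nth_pad N T i : nth [::] (pad N T) i = nth [::] T i.
Proof.
rewrite nth_cat; case: ltnP => // le_i.
by rewrite nth_nseq if_same [RHS]nth_default.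
Qed.

Lemma flatten_trim T : flatten (trim T) = flatten T.
Proof. by elim: T => //= row T IH; case: eqP => [->|_] //=; rewrite IH. Qed.

Lemma cat_trim_nseq T :
  (forall i, size (nth [::] T i.+1) <= size (nth [::] T i))%N ->
  T = trim T ++ nseq (size T - size (trim T)) [::].
Proof.
elim: T => //= row T IH le_sz; case: eqP => [row0|_] /=; last first.
  by rewrite subSS -IH // => i; exact: le_sz i.+1.
have {}IH := IH (fun i => le_sz i.+1).
have T0 i : nth [::] T i = [::].
  apply: size0nil; apply/eqP; rewrite -leqn0.
  elim: i => [|i]; first by have := le_sz 0%N; rewrite row0.
  exact: leq_trans (le_sz i.+1).
have -> : T = nseq (size T) [::].
  apply: (@eq_from_nth _ [::]) => [|i lt_i]; rewrite ?size_nseq //.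
  by rewrite T0 nth_nseq if_same.
have -> k : trim (nseq k [::]) = [::] by elim: k.
by rewrite row0 size_nseq.
Qed.

Lemma padK T : all (fun row => row != [::]) T -> forall N, trim (pad N T) = T.
Proof.
move=> T_ne N; rewrite /trim /pad filter_cat (all_filterP T_ne).
by have -> k : [seq row <- nseq k [::] | row != [::]] = [::] :> seq (seq nat);
  [elim: k | rewrite cats0].
Qed.

Lemma trimK N T : is_tableau N T -> pad N (trim T) = T.
Proof.
move=> [<- tabT]; rewrite /pad -cat_trim_nseq // => i.
by have [] := tabT i.
Qed.

Lemma nth_shape_pad N T i :
  nth 0%N (shape (pad N T)) i = nth 0%N (shape T) i.
Proof. by rewrite !nth_shape nth_pad. Qed.

Lemma trim_ssyt N T : is_tableau N T ->
  is_ssyt (shape (trim T)) (trim T) && is_partition (shape (trim T)).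
Proof.
move=> tabT; have tab i := tabT.2 i.
have trimE i : nth [::] (trim T) i = nth [::] T i.
  by rewrite -{2}(trimK tabT) nth_pad.
rewrite /is_ssyt eqxx /=; apply/andP; split; [apply/andP; split|].
- apply/(all_nthP [::]) => i _; rewrite trimE; by have [] := tab i.
- by apply/(sortedP [::]) => i _; rewrite !trimE; have [] := tab i.
apply/andP; split.
  by apply/(sortedP 0%N) => i _; rewrite !nth_shape !trimE; have [] := tab i.
rewrite all_map; apply/allP => row; rewrite mem_filter => /andP[row_ne _].
by rewrite /= lt0n size_eq0.
Qed.

Lemma pad_tableau N l T : is_partition l -> is_ssyt l T ->
  all (gtn N) (flatten T) -> is_tableau N (pad N T).
Proof.
move=> pl /and3P[/eqP shT rows cols] lt_N.
move: pl; rewrite -shT => /andP[srt]; rewrite all_map => T_ne.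
have lt_row i : all (gtn N) (nth [::] T i).
  have [lt_i|le_i] := ltnP i (size T); last by rewrite nth_default.
  apply/allP => x x_row; apply: (allP lt_N); apply/flattenP.
  by exists (nth [::] T i) => //; exact: mem_nth.
have le_size i : (size (nth [::] T i.+1) <= size (nth [::] T i))%N.
  rewrite -!nth_shape; have [lt_i|le_i] := ltnP i.+1 (size (shape T)).
    exact: (elimT (sortedP 0%N) srt).
  by rewrite nth_default.
(* Stated for any [M] because it serves twice: with [M = size T], to see that a row of index [N]
   would contain an entry at least [N], and then with [M = N]. *)
have tab M : (N <= M)%N -> (size T <= M)%N -> is_tableau M (pad M T).
  move=> le_NM le_TM; split=> [|i]; first by rewrite size_cat size_nseq subnKC.
  rewrite !nth_pad; split=> //.
  - have [lt_i|le_i] := ltnP i (size T); last by rewrite nth_default.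
    exact: (allP rows) _ (mem_nth _ lt_i).
  - have [lt_i|le_i] := ltnP i.+1 (size T).
      exact: (elimT (sortedP [::]) cols).
    by apply/column_strictP; rewrite // [nth _ T i.+1]nth_default.
  - by apply: sub_all (lt_row i) => x /= /leq_trans; apply.
apply: (tab N) => //; rewrite leqNgt; apply/negP => lt_N'.
have tabT := tab _ (ltnW lt_N') (leqnn _).
have row_gt0 : (0 < size (nth [::] T N))%N.
  exact: (allP T_ne) _ (mem_nth _ lt_N').
have := tableau_entry_ge (i := N) (j := 0) tabT.
rewrite nth_pad => /(_ row_gt0).
have /= := allP (lt_row N) _ (mem_nth 0%N row_gt0).
by rewrite [X in is_true X -> _]ltnNge => /negP lt_x /lt_x.
Qed.

(** * Comparison of coefficients at a fixed monomial *)

Section Assembly.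
Variables (R : realType).

Lemma ext_schur_jacobi_trudi (alpha beta : R^nat) gamma l :
  ext_schur alpha beta gamma l =
  jacobi_trudi (ext_h_nat alpha beta gamma) (size l) l.
Proof.
congr (\det _); apply/matrixP => i j; rewrite !mxE /hdiff addrAC.
rewrite -PoszD; case: leqP => [le_i|lt_i]; first by rewrite subzn.
have -> : ((nth 0%N l i + j)%N%:Z - i%:Z) = Negz (i - (nth 0%N l i + j)).-1.
  by rewrite NegzE prednK ?subn_gt0 // -opprB subzn // ltnW.
by [].
Qed.

Lemma jacobi_trudi_trim (h : nat -> R) N T : h 0%N = 1 -> is_tableau N T ->
  jacobi_trudi h N (shape T) =
  jacobi_trudi h (size (shape (trim T))) (shape (trim T)).
Proof.
move=> h0 tabT; rewrite -(jacobi_trudi_pad (n := N)) //; last first.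
  by rewrite size_map -(tabT.1) size_filter count_size.
rewrite /jacobi_trudi; congr (\det _); apply/matrixP => i j; rewrite !mxE.
by rewrite -{1}(trimK tabT) nth_shape_pad.
Qed.

Lemma size_mono_of_seq N s : mono_support N (mono_of_seq s) ->
  all (gtn N) s /\ size s = mono_deg N (mono_of_seq s).
Proof.
move=> supp; have lt_s : all (gtn N) s.
  apply/allP => r rs; rewrite /= ltnNge; apply/negP => /supp.
  by rewrite mono_of_seqE => /count_memPn; rewrite rs.
split=> //; rewrite /mono_deg; under eq_bigr => r _ do rewrite mono_of_seqE.
elim: s lt_s {supp} => [|x s IH] /=; first by rewrite big1.
move=> /andP[lt_x /IH ->]; rewrite big_split /= -add1n; congr addn.
rewrite (bigD1 (Ordinal lt_x)) //= eqxx big1 // => r.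
by rewrite -val_eqE eq_sym /= => /negPf ->.
Qed.

Lemma mono_of_tableau N m T : mono_support N m -> is_tableau N T ->
  (forall r, (r < N)%N -> count_mem r (flatten T) = m r) ->
  mono_of_seq (flatten T) = m.
Proof.
move=> m_supp tabT cntT; apply/fsfunP => r; rewrite mono_of_seqE.
have [/cntT //|le_Nr] := ltnP r N; rewrite m_supp //; apply/count_memPn.
apply/negP => /flattenP[row /(nthP [::])[i _ <-] r_row].
have [_ _ _ /allP/(_ _ r_row)] := tabT.2 i.
by rewrite /= ltnNge le_Nr.
Qed.

(** [trim] is a bijection from the listed tableaux of this shape to the semistandard tableaux with
    monomial [m]; surjectivity holds because the letters of the latter are below [N]. *)
Lemma schurE N l m : is_partition l -> mono_support N m -> schur R l m =
  \sum_(T <- tableaux m N) (shape (trim T) == l)%:R.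
Proof.
move=> pl m_supp; rewrite /schur /fps_sum.
rewrite (fsbigE [seq trim T | T <- tableaux m N & shape (trim T) == l]).
- rewrite big_map big_filter_cond big_mkcond big_seq [RHS]big_seq.
  apply: eq_bigr => T /mem_tableaux[tabT cntT].
  rewrite /fps_mono flatten_trim (mono_of_tableau m_supp) // eqxx.
  case: eqP => //= eq_l; rewrite ifT // inE /=.
  by have /andP[+ _] := trim_ssyt tabT; rewrite eq_l.
- rewrite map_inj_in_uniq ?filter_uniq ?tableaux_uniq // => T T'.
  rewrite !mem_filter => /andP[_ /mem_tableaux[tab _]].
  move=> /andP[_ /mem_tableaux[tab' _]] eqT.
  by rewrite -(trimK tab) eqT trimK.
- move=> _ /mapP[T + ->]; rewrite mem_filter => /andP[/eqP <-].
  by move=> /mem_tableaux[tabT _] /=; have /andP[] := trim_ssyt tabT.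
- move=> T /= ssT; apply: contraNeq; rewrite /fps_mono pnatr_eq0 eqb0 negbK.
  move=> /eqP mT; subst m.
  have [lt_N _] := size_mono_of_seq m_supp.
  have tabT := pad_tableau pl ssT lt_N.
  have T_ne : all (fun row => row != [::]) T.
    move: pl; have /and3P[/eqP <- _ _] := ssT; rewrite /is_partition all_map.
    by case/andP=> _; apply: sub_all => row /=; rewrite lt0n size_eq0.
  apply/mapP; exists (pad N T); last by rewrite padK.
  rewrite mem_filter padK //; have /andP[-> _] /= := ssT.
  apply/mem_tableaux; split=> // r _.
  by rewrite mono_of_seqE -[flatten (pad N T)]flatten_trim padK.
Qed.

Lemma schur_neq0 N l m : mono_support N m -> schur R l m != 0 ->
  sumn l = mono_deg N m.
Proof.
move=> m_supp; rewrite /schur /fps_sum.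
move=> /(@fsbigN1 _ _ _ mono _ _ (fun m T => fps_mono R _ m))[T /= ssT].
rewrite /fps_mono pnatr_eq0 eqb0 negbK => /eqP mT; subst m.
have [_ <-] := size_mono_of_seq m_supp.
by have /andP[/eqP <- _] := ssT; rewrite size_flatten.
Qed.

(** Homogeneity confines the sum at [m] to partitions of the degree of [m], which gives summability
    and the value together. *)
Lemma fps_sum_partitions N (c : seq nat -> R) (F : seq nat -> fps R) m :
  (forall l, is_partition l -> F l m != 0 -> sumn l = mono_deg N m) ->
  finite_set [set l | partitions l /\ fps_scale (c l) (F l) m != 0] /\
  fps_sum partitions (fun l => fps_scale (c l) (F l)) m =
    \sum_(l <- partitions_of (mono_deg N m)) c l * F l m.
Proof.
move=> F0; have in_parts l : partitions l -> fps_scale (c l) (F l) m != 0 ->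
    l \in partitions_of (mono_deg N m).
  rewrite mem_partitions_of /fps_scale mulf_eq0 negb_or.
  move=> pl /andP[_ /F0 ->] //.
  by rewrite eqxx andbT.
split.
  apply: sub_finite_set (finite_seq (partitions_of (mono_deg N m))).
  by move=> l [/in_parts].
rewrite /fps_sum (fsbigE (partitions_of (mono_deg N m))) ?partitions_of_uniq //.
- rewrite big_seq_cond [RHS]big_seq; apply: eq_bigl => l.
  apply: andb_idr; rewrite mem_partitions_of inE => /andP[pl _].
  exact: pl.
- by move=> l /=; rewrite mem_partitions_of => /andP[].
- by move=> l pl; apply: contraNeq => /in_parts; apply.
Qed.

End Assembly.

Theorem theorem5 (R : realType) (alpha beta : R^nat) (gamma : R)
    (alpha_ge0 : forall i : nat, 0 <= alpha i)
    (beta_ge0 : forall i : nat, 0 <= beta i)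
    (alpha_cvg : cvgn (series alpha))
    (beta_cvg : cvgn (series beta))
    (gamma_ge0 : 0 <= gamma) :
  let lhs (l : seq nat) : fps R :=
    fps_scale (ext_schur alpha beta gamma l) (schur R l) in
  let rhs (l : seq nat) : fps R :=
    fps_scale ((z_part l)%:R^-1 * ext_p alpha beta gamma l) (powersum R l) in
  [/\ fps_summable partitions lhs,
      fps_summable partitions rhs
    & fps_sum partitions lhs = fps_sum partitions rhs].
Proof.
move=> lhs rhs; set h := ext_h_nat alpha beta gamma.
have h0 : h 0%N = 1 := ext_h_nat0 alpha beta gamma.
have h_newton := ext_h_nat_newton gamma alpha_ge0 beta_ge0 alpha_cvg beta_cvg.
have lhsP m N (m_supp : mono_support N m) := @fps_sum_partitions R N
  (ext_schur alpha beta gamma) (schur R) m (fun l _ => schur_neq0 m_supp).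
have rhsP m N (m_supp : mono_support N m) := @fps_sum_partitions R N
  (fun l => (z_part l)%:R^-1 * ext_p alpha beta gamma l) (powersum R) m
  (fun l pl => powersum_neq0 (proj2 (andP pl)) m_supp).
split=> [m|m|].
- by have [N m_supp] := mono_support_exists m; have [] := lhsP m N m_supp.
- by have [N m_supp] := mono_support_exists m; have [] := rhsP m N m_supp.
apply/funext => m; have [N m_supp] := mono_support_exists m.
have [_ ->] := lhsP m N m_supp; have [_ ->] := rhsP m N m_supp.
transitivity (\prod_(r < N) h (m r)); last first.
  by rewrite -(sum_powersum h0 h_newton m_supp).
rewrite -(sum_tableaux h m N).
transitivity (\sum_(l <- partitions_of (mono_deg N m))
    \sum_(T <- tableaux m N)
      ext_schur alpha beta gamma l * (shape (trim T) == l)%:R).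
  rewrite big_seq [RHS]big_seq; apply: eq_bigr => l.
  rewrite mem_partitions_of => /andP[pl _].
  by rewrite (schurE R pl m_supp) mulr_sumr.
(* With the tableau outside, the inner sum over partitions has a single nonzero term, the trimmed
   shape. *)
rewrite exchange_big /= big_seq [RHS]big_seq.
apply: eq_bigr => T /mem_tableaux[tabT cntT].
rewrite (jacobi_trudi_trim h0 tabT) -ext_schur_jacobi_trudi.
have /andP[/andP[_ _] p_trim] := trim_ssyt tabT.
have trim_in : shape (trim T) \in partitions_of (mono_deg N m).
  have mT := mono_of_tableau m_supp tabT cntT; move: m_supp; rewrite -mT.
  case/size_mono_of_seq => _ <-.
  by rewrite mem_partitions_of p_trim -size_flatten flatten_trim /=.
rewrite (bigD1_seq _ trim_in (partitions_of_uniq _)) /= eqxx mulr1.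
by rewrite big1 ?addr0 // => l; rewrite eq_sym => /negPf ->; rewrite mulr0.
Qed.
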